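(* For all integers $r$, $s$, $t$ and $n\ge 0$: $$S_{n}^{(s,s+t)}(U)-q^{s-r}S_{n}^{(r,r+t)}(U)=\Delta^{-1}\left(S_{n}^{(s,s+t)}(V)-q^{s-r}S_{n}^{(r,r+t)}(V)\right)=a_{n+1}U_{s-r}U_{2n+r+s+t},$$ $$S_{n}^{(s,s+t)}(V)+\Delta q^{s-r}S_{n}^{(r,r+t)}(U)=a_{n+1}V_{s-r}V_{2n+r+s+t}.$$
   Context: Let $p,q$ be integers with $p\neq 0$, $q\in\{1,-1\}$, and $\Delta:=p^2-4q\neq 0$. The sequences $(U_n)_{n\in\mathbb{Z}}$ and $(V_n)_{n\in\mathbb{Z}}$ are defined by $U_0=0$, $U_1=1$, $V_0=2$, $V_1=p$ and the recurrences $U_n=pU_{n-1}-qU_{n-2}$, $V_n=pV_{n-1}-qV_{n-2}$ for all $n\in\mathbb{Z}$ (so they are extended to negative indices by the recurrence). Under these assumptions $U_2\ne 0$. For $n\in\mathbb{Z}$ define $a_n=\frac{U_{2n}}{U_2}$. For a sequence $X=(X_m)_{m\in\mathbb{Z}}$, integers $r,s$ and $n\ge0$, set $S_n^{(r,s)}(X)=\sum_{i=0}^{n}X_{r+2i}X_{s+2i}$. *)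

(* Defs.v *)
From HB Require Import structures.
From mathcomp Require Import all_boot all_order all_algebra.
From mathcomp Require Import zify ring.

Set Implicit Arguments.
Unset Strict Implicit.
Unset Printing Implicit Defensive.

Import GRing.Theory.
Local Open Scope ring_scope.

(* The state (x, y) stands for two consecutive terms (X_n, X_{n+1}).  The     *)
(* backward step solves X_{n+1} = p X_n - q X_{n-1} for X_{n-1}.              *)
Definition lucas_fwd (p q : int) (u : rat * rat) : rat * rat :=
  (u.2, p%:Q * u.2 - q%:Q * u.1).

Definition lucas_bwd (p q : int) (u : rat * rat) : rat * rat :=
  ((p%:Q * u.1 - u.2) / q%:Q, u.1).

Definition lucas_seq (p q : int) (x0 x1 : rat) (n : int) : rat :=
  match n with
  | Posz m => (iter m (lucas_fwd p q) (x0, x1)).1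
  | Negz m => (iter m.+1 (lucas_bwd p q) (x0, x1)).1
  end.

Definition lucasU (p q : int) : int -> rat := lucas_seq p q 0 1.

Definition lucasV (p q : int) : int -> rat := lucas_seq p q 2 p%:Q.

Definition lucas_disc (p q : int) : int := p ^+ 2 - 4 * q.

Definition lucas_a (p q : int) (n : int) : rat :=
  lucasU p q (2 * n) / lucasU p q 2.

Definition prod_sum (X : int -> rat) (r s : int) (n : nat) : rat :=
  \sum_(0 <= i < n.+1) X (r + 2 * i%:Z) * X (s + 2 * i%:Z).

Lemma lucas_seq0 p q x0 x1 : lucas_seq p q x0 x1 0 = x0.
Proof. by []. Qed.

Lemma lucas_seq1 p q x0 x1 : lucas_seq p q x0 x1 1 = x1.
Proof. by []. Qed.

Lemma lucas_seq_rec (p q : int) (x0 x1 : rat) (n : int) : q != 0 ->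
  lucas_seq p q x0 x1 n =
    p%:Q * lucas_seq p q x0 x1 (n - 1) - q%:Q * lucas_seq p q x0 x1 (n - 2).
Proof.
move=> q0; have qQ0 : q%:Q != 0 by rewrite intr_eq0.
have bwd2 m : (iter m.+1 (lucas_bwd p q) (x0, x1)).2
    = (iter m (lucas_bwd p q) (x0, x1)).1 by [].
case: n => [[|[|m]]|m].
- rewrite [0 - 1](_ : _ = Negz 0)// [0 - 2](_ : _ = Negz 1)//=.
  by field.
- rewrite [Posz 1 - 1](_ : _ = Posz 0)// [Posz 1 - 2](_ : _ = Negz 0)//=.
  by field.
- rewrite [Posz m.+2 - 1](_ : _ = Posz m.+1); last by lia.
  rewrite [Posz m.+2 - 2](_ : _ = Posz m); last by lia.
  by [].
- rewrite [Negz m - 1](_ : _ = Negz m.+1); last by lia.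
  rewrite [Negz m - 2](_ : _ = Negz m.+2); last by lia.
  rewrite /=; set u := iter m _ _.
  by field.
Qed.

(* Main.v *)
Require Import Defs.
From HB Require Import structures.
From mathcomp Require Import all_boot all_order all_algebra.
From mathcomp Require Import zify ring.

(** With [x], [y] the roots of [X^2 - p X + q], Binet's formulas read
    [U n = (x^n - y^n) / (x - y)] and [V n = x^n + y^n], where [x y = q] and
    [(x - y)^2] is the discriminant [D].  Expanding the products gives, with
    [d = s - r], identities such as
    [U s * U (s + t) - q^d * U r * U (r + t) = U d * U (r + s + t)].  Replacing
    [r], [s] by [r + 2 i], [s + 2 i] leaves [d] unchanged and moves the other
    index by [4 i], so after summation the factor [U d] or [V d] comes out and
    there remains the sum of a Lucas sequence [X] along a progression of
    step 4.  Since [q^2 = 1], the same identities with [d = 2] make that sum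
    telescope to [U (2 n + 2) / U 2 * X (m + 2 n)].

    The roots themselves are avoided.  In terms of the pairs [(V n, U n)],
    that is [2 x^n = V n + U n (x - y)], the exponent law becomes the addition
    formulas [lucasUD] and [lucasVD], and [x^n y^n = q^n] becomes the norm
    equation [lucas_norm].  The former follow from the fact that a solution of
    the recurrence is determined by its values at 0 and 1; once they are used
    to expand all indices, and the norm equation to eliminate [q^d], the product
    identities are polynomial identities. *)

Set Implicit Arguments.
Unset Strict Implicit.
Unset Printing Implicit Defensive.

Import Order.TTheory GRing.Theory Num.Theory.
Local Open Scope ring_scope.

(** * Solutions of the recurrence *)

Definition lucas_recurrent (p q : int) (X : int -> rat) :=
  forall n, X n = p%:Q * X (n - 1) - q%:Q * X (n - 2).

Lemma lucasU_rec p q : q != 0 -> lucas_recurrent p q (lucasU p q).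
Proof. by move=> q0 n; exact: lucas_seq_rec. Qed.

Lemma lucasV_rec p q : q != 0 -> lucas_recurrent p q (lucasV p q).
Proof. by move=> q0 n; exact: lucas_seq_rec. Qed.

Lemma lucas_recurrent_shift p q X m :
  lucas_recurrent p q X -> lucas_recurrent p q (fun n => X (m + n)).
Proof. by move=> recX n; rewrite recX !addrA. Qed.

Lemma lucas_recurrent_scale p q X a :
  lucas_recurrent p q X -> lucas_recurrent p q (fun n => a * X n).
Proof. by move=> recX n; rewrite recX; ring. Qed.

Lemma lucas_recurrent_comb p q X Y a b :
    lucas_recurrent p q X -> lucas_recurrent p q Y ->
  lucas_recurrent p q (fun n => a * X n + b * Y n).
Proof. by move=> recX recY n; rewrite recX recY; ring. Qed.

(** Running the recurrence backwards divides by [q], whence [q != 0]. *)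
Lemma lucas_recurrent_inj p q X Y : q != 0 ->
    lucas_recurrent p q X -> lucas_recurrent p q Y ->
  X 0 = Y 0 -> X 1 = Y 1 -> X =1 Y.
Proof.
move=> q0 recX recY eq0 eq1 n.
have qQ0 : q%:Q != 0 by rewrite intr_eq0.
suff [] : X n = Y n /\ X (n + 1) = Y (n + 1) by [].
elim/int_rect: n => [|n [IH0 IH1]|n [IH0 IH1]]; first by [].
- have -> : n.+1%:Z = n%:Z + 1 by lia.
  split=> //; rewrite recX recY.
  have -> : n%:Z + 1 + 1 - 1 = n%:Z + 1 by lia.
  have -> : n%:Z + 1 + 1 - 2 = n%:Z by lia.
  by rewrite IH0 IH1.
- have eqn : - n.+1%:Z + 1 = - n%:Z by lia.
  rewrite eqn; split=> //; apply: (mulfI qQ0).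
  move: IH1; rewrite recX recY.
  have -> : - n%:Z + 1 - 1 = - n%:Z by lia.
  have -> : - n%:Z + 1 - 2 = - n.+1%:Z by lia.
  by rewrite IH0 => /addrI/oppr_inj.
Qed.

(** * Addition formulas and product identities *)

Section Identities.

Variables (p q : int).
Hypothesis q0 : q != 0.

Let U := lucasU p q.
Let V := lucasV p q.
Let D := (lucas_disc p q)%:Q.

Let recU : lucas_recurrent p q U := lucasU_rec p q0.
Let recV : lucas_recurrent p q V := lucasV_rec p q0.
Let U0 : U 0 = 0 := erefl.
Let U1 : U 1 = 1 := erefl.
Let V0 : V 0 = 2 := erefl.
Let V1 : V 1 = p%:Q := erefl.

Lemma lucas_discE : D = p%:Q ^+ 2 - 4 * q%:Q.
Proof. by rewrite /D /lucas_disc rmorphB rmorphXn rmorphM. Qed.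

Lemma lucasU2 : U 2 = p%:Q.
Proof.
rewrite recU (_ : 2 - 1 = 1 :> int) // (_ : 2 - 2 = 0 :> int) // U0 U1.
by rewrite mulr1 mulr0 subr0.
Qed.

Lemma lucasV2 : V 2 = p%:Q ^+ 2 - 2 * q%:Q.
Proof.
rewrite recV (_ : 2 - 1 = 1 :> int) // (_ : 2 - 2 = 0 :> int) // V0 V1; ring.
Qed.

(** The factor 1 keeps the right-hand side a linear combination in the form
    of [lucas_recurrent_comb]. *)
Lemma lucasUD1 m : 2 * U (m + 1) = p%:Q * U m + 1 * V m.
Proof.
rewrite [m + 1]addrC.
move: m; apply: (@lucas_recurrent_inj p q) => //.
- exact: lucas_recurrent_scale (lucas_recurrent_shift 1 recU).
- exact: lucas_recurrent_comb.
- by rewrite addr0 U0 U1 V0; ring.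
- by rewrite (_ : 1 + 1 = 2 :> int) // lucasU2 U1 V1; ring.
Qed.

Lemma lucasVD1 m : 2 * V (m + 1) = D * U m + p%:Q * V m.
Proof.
rewrite [m + 1]addrC.
move: m; apply: (@lucas_recurrent_inj p q) => //.
- exact: lucas_recurrent_scale (lucas_recurrent_shift 1 recV).
- exact: lucas_recurrent_comb.
- by rewrite addr0 U0 V0 V1; ring.
- by rewrite (_ : 1 + 1 = 2 :> int) // lucasV2 U1 V1 lucas_discE; ring.
Qed.

Lemma lucasUD m n : U (m + n) = (U m * V n + V m * U n) / 2.
Proof.
suff eqU : 2 * U (m + n) = U m * V n + V m * U n by rewrite -eqU; field.
move: n; apply: (@lucas_recurrent_inj p q) => //.
- exact: lucas_recurrent_scale (lucas_recurrent_shift m recU).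
- exact: lucas_recurrent_comb.
- by rewrite [m + 0]addr0 U0 V0; ring.
- by rewrite lucasUD1 U1 V1; ring.
Qed.

Lemma lucasVD m n : V (m + n) = (V m * V n + D * U m * U n) / 2.
Proof.
suff eqV : 2 * V (m + n) = V m * V n + D * U m * U n by rewrite -eqV; field.
move: n; apply: (@lucas_recurrent_inj p q) => //.
- exact: lucas_recurrent_scale (lucas_recurrent_shift m recV).
- exact: lucas_recurrent_comb.
- by rewrite [m + 0]addr0 U0 V0; ring.
- by rewrite lucasVD1 U1 V1; ring.
Qed.

(** [V n ^ 2 - D * U n ^ 2] is four times the norm of [x^n], hence is
    multiplicative up to that factor, by the addition formulas. *)
Lemma lucas_norm n : q%:Q ^ n = (V n ^+ 2 - D * U n ^+ 2) / 4.
Proof.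
have qQ0 : q%:Q != 0 by rewrite intr_eq0.
have normD1 m :
    V (m + 1) ^+ 2 - D * U (m + 1) ^+ 2 = q%:Q * (V m ^+ 2 - D * U m ^+ 2).
  by rewrite lucasUD lucasVD U1 V1 lucas_discE; field.
elim/int_rect: n => [|n IH|n IH].
- by rewrite expr0z U0 V0; field.
- have -> : n.+1%:Z = n%:Z + 1 by lia.
  by rewrite normD1 expfzDr // expr1z IH; ring.
- have eqn : - n%:Z = - n.+1%:Z + 1 by lia.
  move: IH; rewrite eqn normD1 expfzDr // expr1z => IH.
  by apply: (mulIf qQ0); rewrite IH; ring.
Qed.

Section Products.

Variables (r s t : int).

Let s_split : s = r + (s - r).
Proof. by rewrite addrC subrK. Qed.

Let st_split : s + t = r + (s - r) + t.
Proof. by rewrite -s_split. Qed.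

Let rst_split : r + s + t = r + (r + (s - r)) + t.
Proof. by rewrite -s_split. Qed.

Lemma lucasUU_prod :
  U s * U (s + t) - q%:Q ^ (s - r) * (U r * U (r + t))
    = U (s - r) * U (r + s + t).
Proof.
rewrite rst_split st_split [U s](congr1 U s_split) lucas_norm.
by rewrite !(lucasUD, lucasVD); field.
Qed.

Lemma lucasVV_prod :
  V s * V (s + t) - q%:Q ^ (s - r) * (V r * V (r + t))
    = D * (U (s - r) * U (r + s + t)).
Proof.
rewrite rst_split st_split [V s](congr1 V s_split) lucas_norm.
by rewrite !(lucasUD, lucasVD); field.
Qed.

Lemma lucasVU_prod :
  V s * V (s + t) + D * q%:Q ^ (s - r) * (U r * U (r + t))
    = V (s - r) * V (r + s + t).
Proof.
rewrite rst_split st_split [V s](congr1 V s_split) lucas_norm.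
by rewrite !(lucasUD, lucasVD); field.
Qed.

Lemma lucasUV_prod :
  U s * V (s + t) - q%:Q ^ (s - r) * (U r * V (r + t))
    = U (s - r) * V (r + s + t).
Proof.
rewrite rst_split st_split [U s](congr1 U s_split) lucas_norm.
by rewrite !(lucasUD, lucasVD); field.
Qed.

End Products.

(** * Summation *)

Hypotheses (p0 : p != 0) (q2 : q ^+ 2 = 1).

(** The terms telescope: [X_(m + 4 i)] is the increment of
    [U_(2 i) * X_(m + 2 i - 2) / U_2]. *)
Lemma sum_step4 (X : int -> rat) (m : int) (n : nat) :
    (forall r s t, U s * X (s + t) - q%:Q ^ (s - r) * (U r * X (r + t))
                     = U (s - r) * X (r + s + t)) ->
  \sum_(0 <= i < n.+1) X (m + 4 * i%:Z)
    = lucas_a p q (n%:Z + 1) * X (m + 2 * n%:Z).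
Proof.
move=> UX_prod.
have U2_neq0 : U 2 != 0 by rewrite lucasU2 intr_eq0.
pose f (i : nat) := U (2 * i%:Z) * X (2 * i%:Z + (m - 2)).
have step i : U 2 * X (m + 4 * i%:Z) = f i.+1 - f i.
  have := UX_prod (2 * i%:Z) (2 * i.+1%:Z) (m - 2).
  have -> : 2 * i.+1%:Z - 2 * i%:Z = 2 by lia.
  have -> : q%:Q ^ 2%:Z = 1 by rewrite -exprnP -rmorphXn /= q2.
  have -> : 2 * i%:Z + 2 * i.+1%:Z + (m - 2) = m + 4 * i%:Z by lia.
  by rewrite mul1r.
apply: (mulfI U2_neq0); rewrite mulr_sumr (eq_bigr _ (fun i _ => step i)).
rewrite telescope_sumr // /f mulr0 U0 mul0r subr0.
have -> : n.+1%:Z = n%:Z + 1 by lia.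
have -> : 2 * (n%:Z + 1) + (m - 2) = m + 2 * n%:Z by lia.
by rewrite /lucas_a -/U; field.
Qed.

End Identities.

(** The shift of [r] and [s] by [2 i] leaves [s - r] unchanged, so the
    coefficients [c (s - r)] and [e (s - r)] of a product identity are common to
    all terms of the sum. *)
Lemma prod_sum_comb (X Y Z : int -> rat) (c e : int -> rat) :
    (forall r s t, X s * X (s + t) + e (s - r) * (Y r * Y (r + t))
                     = c (s - r) * Z (r + s + t)) ->
  forall r s t n,
    prod_sum X s (s + t) n + e (s - r) * prod_sum Y r (r + t) n
      = c (s - r) * \sum_(0 <= i < n.+1) Z (r + s + t + 4 * i%:Z).
Proof.
move=> XYZ r s t n; rewrite !mulr_sumr -big_split /=.
apply: eq_bigr => i _; have := XYZ (r + 2 * i%:Z) (s + 2 * i%:Z) t.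
have -> : s + 2 * i%:Z - (r + 2 * i%:Z) = s - r by lia.
have -> : r + 2 * i%:Z + (s + 2 * i%:Z) + t = r + s + t + 4 * i%:Z by lia.
by rewrite (addrAC s _ t) (addrAC r _ t).
Qed.

Theorem corollary3 (p q : int) (hp : p != 0) (hq : q = 1 \/ q = -1)
    (hD : lucas_disc p q != 0) (r s t : int) (n : nat) :
  let U := lucasU p q in
  let V := lucasV p q in
  let a := lucas_a p q in
  let D := (lucas_disc p q)%:Q in
  let Q := q%:Q ^ (s - r) in
  [/\ prod_sum U s (s + t) n - Q * prod_sum U r (r + t) n
        = D^-1 * (prod_sum V s (s + t) n - Q * prod_sum V r (r + t) n),
      D^-1 * (prod_sum V s (s + t) n - Q * prod_sum V r (r + t) n)
        = a (n%:Z + 1) * U (s - r) * U (2 * n%:Z + r + s + t)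
    & prod_sum V s (s + t) n + D * Q * prod_sum U r (r + t) n
        = a (n%:Z + 1) * V (s - r) * V (2 * n%:Z + r + s + t)].
Proof.
move=> U V a D Q.
have q0 : q != 0 by case: hq => ->.
have q2 : q ^+ 2 = 1 by case: hq => ->.
have D0 : D != 0 by rewrite intr_eq0.
have eq_index : 2 * n%:Z + r + s + t = r + s + t + 2 * n%:Z by lia.
have sumU := sum_step4 q0 hp q2 (r + s + t) n (lucasUU_prod p q0).
have sumV := sum_step4 q0 hp q2 (r + s + t) n (lucasUV_prod p q0).
have sumUU : prod_sum U s (s + t) n - Q * prod_sum U r (r + t) n
    = a (n%:Z + 1) * U (s - r) * U (2 * n%:Z + r + s + t).
  rewrite eq_index [RHS]mulrAC -sumU [RHS]mulrC -mulNr.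
  apply: (prod_sum_comb (c := U) (e := fun d => - q%:Q ^ d)) => r' s' t'.
  by rewrite mulNr lucasUU_prod.
have sumVV : prod_sum V s (s + t) n - Q * prod_sum V r (r + t) n
    = D * (a (n%:Z + 1) * U (s - r) * U (2 * n%:Z + r + s + t)).
  rewrite eq_index [a _ * _ * _]mulrAC -sumU [_ * U (s - r)]mulrC mulrA -mulNr.
  apply: (prod_sum_comb (c := fun d => D * U d) (e := fun d => - q%:Q ^ d)).
  by move=> r' s' t'; rewrite mulNr lucasVV_prod // mulrA.
split.
- by rewrite sumUU sumVV mulKf.
- by rewrite sumVV mulKf.
rewrite eq_index [RHS]mulrAC -sumV [RHS]mulrC.
apply: (prod_sum_comb (c := V) (e := fun d => D * q%:Q ^ d)) => r' s' t'.
exact: lucasVU_prod.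
Qed.
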